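(* Let $\kappa_1>0$, $\kappa_2\ge 0$, $L>0$ be fixed, and let $G=G_N$ be a sequence of $N\times N$ random matrices satisfying the Noise Assumption (see context) with exponent $\kappa_1$. Let $C,K>0$ be fixed constants. Then for any fixed sufficiently large $\gamma$ (that is, there is $\gamma_0\ge 1$ depending only on $\kappa_1,\kappa_2,L$ such that the following holds for every fixed $\gamma\ge\gamma_0$) there exist constants $c_0>0$ and $C_0>0$, independent of $N$ and of the objects $A,\alpha,\nu_N,\tau,\delta$ below, such that the following holds for all $N\ge 2$. Let $A=A_N$ be a deterministic complex $N\times N$ matrix with $\|A\|\le K N^{\kappa_2}$ and with singular values $s_1\ge\dots\ge s_N\ge 0$. Suppose that $\alpha=\alpha_N$ satisfies $$C N^{-L}\le \alpha\le 1$$ and $$\#\{j:\ s_j\in[0,\alpha]\}\le \nu_N\,\frac{N}{\log N},$$ where $\nu_N\ge 0$ and $\nu_N=o(1)$ as $N\to\infty$. Let $\tau>0$ and let $\delta$ satisfy $$N^{-\gamma}\le \delta\le c_0\,N^{-\kappa_1}\alpha\,\tau^{-1}.$$ Then, with probability at least $1-\varepsilon_N(\kappa_2+\gamma)-\tau^{-1}$, $$\left|\frac1N\log|\det(A+\delta G)|-\frac1N\sum_{j:\ s_j>\alpha}\log s_j\right|\le C_0\left(\nu_N+\alpha^{-1}N^{\kappa_1}\delta\tau\right).$$ Here $\varepsilon_N(\kappa_2+\gamma)$ is the quantity $\varepsilon_N(\theta)$ of the Noise Assumption for $\theta=\kappa_2+\gamma$ (with norm constant $K$).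
   Context: For a complex $N\times N$ matrix $B$, $s_1(B)\ge\dots\ge s_N(B)\ge 0$ denote its singular values and $\|B\|=s_1(B)$ its operator norm. The parameters $\alpha,\tau,\delta,\nu_N$ may depend on $N$; $\kappa_1,\kappa_2,L,\gamma,C,K$ do not. Noise Assumption (with exponent $\kappa_1>0$) on the sequence of $N\times N$ random matrices $G=G_N$: (1) Norm bound: there is a constant $C_1>0$ such that $\mathbb{E}[\|G_N\|]\le C_1 N^{\kappa_1}$ for all $N$. (2) Anti-concentration bound: for each $\theta>0$ there exists $\beta=\beta(\theta)>0$ such that for deterministic complex $N\times N$ matrices $D$ with $\|D\|=O(N^{\theta})$ one has $\mathbf{P}(s_N(D+G_N)\le N^{-\beta})\le\varepsilon_N(\theta)$ with $\varepsilon_N(\theta)=o(1)$ as $N\to\infty$. Explicitly: for every constant $K>0$ there is a sequence $\varepsilon_N(\theta)=\varepsilon_N(\theta,K)\to 0$ such that $\mathbf{P}(s_N(D+G_N)\le N^{-\beta})\le\varepsilon_N(\theta)$ for every $N$ and every deterministic $D\in\mathbb{C}^{N\times N}$ with $\|D\|\le K N^{\theta}$. For each $\theta$ a choice of $\beta(\theta)$ and $\varepsilon_N(\theta)$ is fixed. The constants $c_0,C_0$ in the claim may depend on $\kappa_1,\kappa_2,L,\gamma,C,K,C_1$ and $\beta(\kappa_2+\gamma)$. *)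

(* Defs.v *)
From mathcomp Require Export all_boot all_order all_algebra.
From mathcomp Require Export complex.
From mathcomp Require Export all_classical all_reals all_analysis.
Export Order.TTheory GRing.Theory Num.Theory.
Export numFieldNormedType.Exports.

Set Implicit Arguments.
Unset Strict Implicit.
Unset Printing Implicit Defensive.

Local Open Scope ring_scope.
Local Open Scope classical_set_scope.
Local Open Scope sesquilinear_scope.

Section SingularValues.
Variables (R : realType) (N : nat).
Implicit Type B : 'M[R[i]]_N.

(* B^* B is Hermitian, so the entries of its [spectral_diag] are real: they are
   its eigenvalues, with multiplicity, in an unspecified order. *)
Definition singular_values B : seq R :=
  sort (fun x y => y <= x)
    [seq Num.sqrt (complex.Re (spectral_diag (B ^t* *m B) 0 j)) | j : 'I_N].

(* 1-based: [singval B 1] is the largest and [singval B N] the smallest one. *)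
Definition singval B (j : nat) : R := nth 0 (singular_values B) j.-1.

Definition opnorm B : R := singval B 1.

End SingularValues.

Definition random_matrix (R : realType) (d : measure_display)
    (T : measurableType d) (N : nat) (G : T -> 'M[R[i]]_N) : Prop :=
  forall i j, measurable_fun setT (fun w => complex.Re (G w i j)) /\
              measurable_fun setT (fun w => complex.Im (G w i j)).

(* [beta theta] and [eps theta K] are the fixed choices of beta(theta) and of
   the sequence eps_N(theta, K); beta does not depend on the norm constant K. *)
Record noise_assumption (R : realType) (d : nat -> measure_display)
    (T : forall N, measurableType (d N)) (P : forall N, probability (T N) R)
    (G : forall N, T N -> 'M[R[i]]_N) (kappa1 C1 : R)
    (beta : R -> R) (eps : R -> R -> nat -> R) : Prop := NoiseAssumption {
  noise_random : forall N, random_matrix (G N);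
  noise_norm : forall N, (0 < N)%N ->
    ('E_(P N)[fun w => opnorm (G N w)] <= (C1 * N%:R `^ kappa1)%:E)%E;
  noise_beta_gt0 : forall theta : R, 0 < theta -> 0 < beta theta;
  noise_eps_cvg0 : forall theta K : R, 0 < theta -> 0 < K ->
    eps theta K @ \oo --> (0 : R);
  noise_anticoncentration : forall theta K : R, 0 < theta -> 0 < K ->
    forall N (D : 'M[R[i]]_N), (0 < N)%N ->
    opnorm D <= K * N%:R `^ theta ->
    (P N [set w | (singval (D + G N w) N <= N%:R `^ (- beta theta))%R]
      <= (eps theta K N)%:E)%E
}.

(* Main.v *)
Require Import Defs.
From mathcomp Require Import measurable_realfun.
From mathcomp Require Import lra ring.

(* On an event of probability at least 1 - eps - 1/tau, Markov's inequality
   bounds the norm of delta G by eta = C1 N^kappa1 delta tau <= alpha / 2, and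
   anti-concentration bounds the least singular value of
   A + delta G = delta (A / delta + G) from below by N^-(gamma + b).  Since |det B| is the product of the singular values of B,
   Weyl's inequality compares log |det (A + delta G)| with the truncated sum
   term by term: a singular value of A above alpha contributes an error of at
   most 2 eta / alpha, and each of the at most nu N / log N others contributes
   at most (gamma + b + 1) log N.

   Measurability of the events defined by the extreme singular values comes
   from the fact that a monic polynomial with real roots has only negative
   roots iff its coefficients are all positive, applied to the characteristic
   polynomial of a + c B^* B: its coefficients are polynomials in the entries
   of B and their conjugates. *)

Set Implicit Arguments.
Unset Strict Implicit.
Unset Printing Implicit Defensive.

Local Open Scope ring_scope.
Local Open Scope classical_set_scope.
Local Open Scope sesquilinear_scope.
Local Open Scope complex_scope.

(** * Euclidean norm of complex row vectors *)

Section RowNorm.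
Variable R : realType.

(** The complex number [sqrtC (dotmx x x)] is already real and nonnegative; taking its real part
    only moves it to [R], where the order is total. *)
Definition rnorm n (x : 'rV[R[i]]_n) : R := complex.Re (sqrtC (dotmx x x)).

Lemma rnormE n (x : 'rV[R[i]]_n) : (rnorm x)%:C = sqrtC (dotmx x x).
Proof. by apply: RRe_real; rewrite ger0_real// sqrt_dnorm_ge0. Qed.

Lemma rnorm_ge0 n (x : 'rV[R[i]]_n) : 0 <= rnorm x.
Proof. by rewrite -ler0c rnormE sqrt_dnorm_ge0. Qed.

Lemma rnorm_gt0 n (x : 'rV[R[i]]_n) : (0 < rnorm x) = (x != 0).
Proof. by rewrite -ltcR rnormE sqrt_dnorm_gt0. Qed.

Lemma sqr_rnorm n (x : 'rV[R[i]]_n) : (rnorm x ^+ 2)%:C = dotmx x x.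
Proof. by rewrite rmorphXn /= rnormE sqrtCK. Qed.

Lemma ler_rnormD n (x y : 'rV[R[i]]_n) : rnorm (x + y) <= rnorm x + rnorm y.
Proof.
rewrite -lecR (rmorphD (real_complex R)).
rewrite [X in X <= _]rnormE [X in _ <= X + _]rnormE [X in _ <= _ + X]rnormE.
exact: (triangle_lerif (@dotmx _ n) x y).1.
Qed.

Lemma rnormZ n (a : R) (x : 'rV[R[i]]_n) : 0 <= a ->
  rnorm (a%:C *: x) = a * rnorm x.
Proof.
move=> a0; apply/eqP; rewrite -(@eqrXn2 _ 2) ?mulr_ge0 ?rnorm_ge0//.
apply/eqP/complexI; rewrite /= exprMn sqr_rnorm (dnormZ (@dotmx _ n)).
by rewrite rmorphM /= sqr_rnorm rmorphXn /= ger0_norm// ler0c.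
Qed.

End RowNorm.

(** * Diagonalization of the Gram matrix *)

Section SpectralCoordinates.
Variables (R : realType) (n : nat).
Implicit Types (B : 'M[R[i]]_n) (x : 'rV[R[i]]_n).

Definition gram B := B ^t* *m B.
Definition gram_basis B := spectralmx (gram B).

(* The singular values in the order of [spectral_diag], before sorting. *)
Definition sv B (j : 'I_n) : R :=
  Num.sqrt (complex.Re (spectral_diag (gram B) 0 j)).

Lemma gram_normal B : gram B \is normalmx.
Proof.
apply: hermitian_normalmx; apply/is_hermitianmxP.
by rewrite expr0 scale1r /gram trmx_mul map_mxM /= trmxCK.
Qed.

Lemma gram_spectral B :
  gram B = (gram_basis B)^t* *m diag_mx (spectral_diag (gram B)) *m gram_basis B.
Proof.
rewrite -invmx_unitary ?spectral_unitarymx//.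
exact/orthomx_spectralP/gram_normal.
Qed.

(** Coordinates of [x] in the orthonormal basis formed by the rows of [gram_basis B], which are left
    eigenvectors of [gram B]. *)
Definition coordmx B x := x *m (gram_basis B)^t*.

Lemma coordmxK B x : coordmx B x *m gram_basis B = x.
Proof.
by rewrite /coordmx -invmx_unitary ?spectral_unitarymx// mulmxKV ?spectral_unit.
Qed.

Lemma dotmx_mul B x : dotmx (x *m B^t*) (x *m B^t*) =
  \sum_j spectral_diag (gram B) 0 j * `|coordmx B x 0 j| ^+ 2.
Proof.
rewrite dotmxE trmx_mul map_mxM /= trmxCK !mulmxA -(mulmxA x) -/(gram B).
rewrite [in LHS]gram_spectral !mulmxA -/(coordmx B x) -(mulmxA _ (gram_basis B)).
have -> : gram_basis B *m x^t* = (coordmx B x)^t*.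
  by rewrite /coordmx trmx_mul map_mxM /= trmxCK.
rewrite mul_mx_diag mxE; apply: eq_bigr => j _.
by rewrite !mxE normCK mulrAC mulrC.
Qed.

(** [Num.sqrt] sends negative reals to 0, so each eigenvalue must be shown nonnegative: it is the
    squared norm of the image of a unit eigenvector. *)
Lemma sv_sqr B j : (sv B j ^+ 2)%:C = spectral_diag (gram B) 0 j.
Proof.
have d0 : 0 <= spectral_diag (gram B) 0 j.
  pose x : 'rV_n := delta_mx 0 j *m gram_basis B.
  have : 0 <= dotmx (x *m B^t*) (x *m B^t*).
    exact: (dnorm_ge0 (@dotmx _ n)).
  rewrite dotmx_mul /coordmx /x.
  have /unitarymxP bb := spectral_unitarymx (gram B).
  rewrite -mulmxA bb mulmx1 (bigD1 j)//= big1 => [|i ij].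
    by rewrite mxE !eqxx normr1 expr1n mulr1 addr0.
  by rewrite mxE (negbTE ij) andbF normr0 expr0n mulr0.
rewrite sqr_sqrtr; first by rewrite RRe_real// ger0_real.
by move: d0; rewrite lecE => /andP[].
Qed.

Lemma sv_ge0 B j : 0 <= sv B j. Proof. exact: sqrtr_ge0. Qed.

Lemma sqr_rnorm_mul B x : rnorm (x *m B^t*) ^+ 2 =
  \sum_j sv B j ^+ 2 * Normc.normc (coordmx B x 0 j) ^+ 2.
Proof.
apply: complexI; rewrite /= sqr_rnorm dotmx_mul rmorph_sum /=.
by apply: eq_bigr => j _; rewrite -sv_sqr -rmorphXn -rmorphM.
Qed.

Lemma sqr_rnorm_coord B x :
  rnorm x ^+ 2 = \sum_j Normc.normc (coordmx B x 0 j) ^+ 2.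
Proof.
apply: complexI; rewrite /= sqr_rnorm rmorph_sum /=.
rewrite -{1 2}(coordmxK B x) dotmxE trmx_mul map_mxM /=.
rewrite mulmxA -(mulmxA _ (gram_basis B)).
have /unitarymxP -> := spectral_unitarymx (gram B).
rewrite mulmx1 mxE; apply: eq_bigr => j _.
by rewrite !mxE -normCK rmorphXn.
Qed.

(** The bound on [sv] is asked only where [x] has a nonzero coordinate, so that it applies to spans
    of selected eigenvectors. *)
Lemma rnorm_mul_le B x (t : R) : 0 <= t ->
  (forall j, coordmx B x 0 j != 0 -> sv B j <= t) ->
  rnorm (x *m B^t*) <= t * rnorm x.
Proof.
move=> t0 h; rewrite -(@ler_pXn2r _ 2)// ?nnegrE ?mulr_ge0 ?rnorm_ge0//.
rewrite exprMn sqr_rnorm_mul (sqr_rnorm_coord B) mulr_sumr; apply: ler_sum => j _.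
have [->|/h svt] := eqVneq (coordmx B x 0 j) 0.
  by rewrite Normc.normc0 expr0n !mulr0.
by rewrite ler_wpM2r ?sqr_ge0// lerXn2r// nnegrE ?sv_ge0.
Qed.

Lemma rnorm_mul_ge B x (t : R) : 0 <= t ->
  (forall j, coordmx B x 0 j != 0 -> t <= sv B j) ->
  t * rnorm x <= rnorm (x *m B^t*).
Proof.
move=> t0 h; rewrite -(@ler_pXn2r _ 2)// ?nnegrE ?mulr_ge0 ?rnorm_ge0//.
rewrite exprMn sqr_rnorm_mul (sqr_rnorm_coord B) mulr_sumr; apply: ler_sum => j _.
have [->|/h svt] := eqVneq (coordmx B x 0 j) 0.
  by rewrite Normc.normc0 expr0n !mulr0.
by rewrite ler_wpM2r ?sqr_ge0// lerXn2r// nnegrE ?sv_ge0.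
Qed.

(** Both sides are nonnegative and their squares agree: |det B|^2 = det (B^* B) is the product of
    the eigenvalues of the Gram matrix. *)
Lemma det_sv B : Normc.normc (\det B) = \prod_j sv B j.
Proof.
apply/eqP; rewrite -(@eqrXn2 _ 2) ?prodr_ge0//; first last.
- by move=> j _; exact: sv_ge0.
- by rewrite -ler0c; exact: (normr_ge0 (\det B)).
apply/eqP/complexI; rewrite -prodrXl rmorph_prod /= rmorphXn /=.
transitivity (\det (gram B)).
  rewrite /gram det_mulmx det_map_mx det_tr mulrC -normCK; by [].
rewrite gram_spectral -invmx_unitary ?spectral_unitarymx//.
rewrite !det_mulmx det_inv mulrAC mulVr ?mul1r -?unitmxE ?spectral_unit//.
by rewrite det_diag; apply: eq_bigr => j _; rewrite -sv_sqr.
Qed.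

End SpectralCoordinates.

(** * Counting in decreasing sequences and counting dimensions *)

Section SortedCount.
Variable R : realType.
Implicit Type s : seq R.

(** In a decreasing sequence only the [k] entries before position [k] can exceed the entry there. *)
Lemma count_gt_nth s k : sorted (fun x y => y <= x) s ->
  (count (fun x : R => (nth 0 s k < x)%R) s <= k)%N.
Proof.
move=> ss; have [sk|ks] := leqP (size s) k.
  exact: leq_trans (count_size _ _) sk.
rewrite -[X in count _ X](cat_take_drop k) count_cat.
rewrite [X in (_ + X)%N](_ : _ = 0%N); last first.
  apply/eqP; rewrite -leqn0 leqNgt -has_count; apply/hasPn => x /(nthP 0) [m].
  rewrite size_drop ltn_subRL => mk <-; rewrite nth_drop -leNgt.
  have rtr : transitive (fun x y : R => y <= x).
    by move=> a b c /[swap]; exact: le_trans.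
  by apply: (sorted_leq_nth rtr (@lexx _ R)); rewrite ?inE ?leq_addr.
by rewrite addn0 (leq_trans (count_size _ _))// size_take ks.
Qed.

Lemma count_lt_nth s k : sorted (fun x y => y <= x) s -> (k < size s)%N ->
  (count (fun x : R => (x < nth 0 s k)%R) s < size s - k)%N.
Proof.
move=> ss ks; rewrite -[X in count _ X](cat_take_drop k.+1) count_cat.
rewrite [X in (X + _)%N](_ : _ = 0%N); last first.
  apply/eqP; rewrite -leqn0 leqNgt -has_count; apply/hasPn => x /(nthP 0) [m].
  rewrite size_take_min => mk <-.
  have mk' : (m < k.+1)%N by rewrite (leq_trans mk)// geq_minl.
  rewrite nth_take// -leNgt.
  have rtr : transitive (fun x y : R => y <= x).
    by move=> a b c /[swap]; exact: le_trans.
  apply: (sorted_leq_nth rtr (@lexx _ R)); rewrite ?inE//.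
  by rewrite (leq_trans mk)// geq_minr.
by rewrite add0n (leq_ltn_trans (count_size _ _))// size_drop subnS prednK ?subn_gt0.
Qed.

End SortedCount.

(** Together the two equations impose [p + q < n] linear conditions, so the block matrix
    [row_mx U V] has a nonzero left kernel. *)
Lemma card_lt_exists_orthogonal (F : fieldType) (n p q : nat) (U : 'M[F]_(n, p))
    (V : 'M[F]_(n, q)) : (p + q < n)%N ->
  exists x : 'rV[F]_n, [/\ x != 0, x *m U = 0 & x *m V = 0].
Proof.
move=> pqn; pose M := row_mx U V.
have : kermx M != 0.
  rewrite -mxrank_eq0 mxrank_ker subn_eq0 -ltnNge.
  exact: leq_ltn_trans (rank_leq_col _) pqn.
case/rowV0Pn => x /sub_kermxP; rewrite mul_mx_row -[0 in RHS]row_mx0.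
by move=> /eq_row_mx[xU xV] x0; exists x.
Qed.

(** * Comparison of singular values, Weyl's inequality and scaling *)

Section SingularValues.
Variables (R : realType) (n : nat).
Implicit Types A B : 'M[R[i]]_n.

Lemma perm_singular_values B :
  perm_eq (singular_values B) [seq sv B j | j : 'I_n].
Proof. by rewrite /singular_values perm_sort perm_refl. Qed.

Lemma size_singular_values B : size (singular_values B) = n.
Proof. by rewrite (perm_size (perm_singular_values B)) size_map size_enum_ord. Qed.

Lemma sorted_singular_values B : sorted (fun x y : R => y <= x) (singular_values B).
Proof. by apply: sort_sorted => x y; rewrite le_total. Qed.

Lemma count_singular_values B (p : pred R) :
  count p (singular_values B) = #|[pred j | p (sv B j)]|.
Proof.
rewrite (permP (perm_singular_values B)) count_map cardE size_filter.
by rewrite enumT.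
Qed.

Lemma singular_values_ge0 B s : s \in singular_values B -> 0 <= s.
Proof.
by rewrite (perm_mem (perm_singular_values B)) => /mapP[j _ ->]; exact: sv_ge0.
Qed.

(** This is the Courant-Fischer argument. At most [k] spectral directions of [A] exceed [a], and
    fewer than [n - k] of [B] lie below [b], so some nonzero [x] avoids them all. The case c = 1
    yields Weyl's inequality, the case e = 0 yields scaling. *)
Lemma nth_singular_values_le A B (c e : R) k : 0 <= c -> 0 <= e -> (k < n)%N ->
  (forall x : 'rV_n, rnorm (x *m B^t*) <= c * rnorm (x *m A^t*) + e * rnorm x) ->
  nth 0 (singular_values B) k <= c * nth 0 (singular_values A) k + e.
Proof.
move=> c0 e0 kn h; set a := nth 0 (singular_values A) k.
set b := nth 0 (singular_values B) k.
have mem s (D : 'M[R[i]]_n) : s = nth 0 (singular_values D) k -> 0 <= s.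
  by move=> ->; apply: (@singular_values_ge0 D); rewrite mem_nth ?size_singular_values.
have a0 : 0 <= a by exact: (mem _ A).
have b0 : 0 <= b by exact: (mem _ B).
pose JA := [pred j | a < sv A j]; pose JB := [pred j | sv B j < b].
have JAk : (#|JA| <= k)%N.
  rewrite -(count_singular_values A (fun x : R => a < x)).
  by rewrite count_gt_nth ?sorted_singular_values.
have JBk : (#|JB| < n - k)%N.
  rewrite -(count_singular_values B (fun x : R => x < b)).
  rewrite -[X in (X - k)%N](size_singular_values B).
  by rewrite count_lt_nth ?sorted_singular_values ?size_singular_values.
have JAB : (#|JA| + #|JB| < n)%N.
  by rewrite -[X in (_ < X)%N](subnKC (ltnW kn)) -addnS leq_add.
(* [f D J] keeps the columns indexed by [J]: [x *m f D J = 0] says that the coordinates of [x] in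
   [J] vanish. *)
pose f (D : 'M[R[i]]_n) (J : pred 'I_n) := colsub (@enum_val _ J) ((gram_basis D)^t*).
have [x [x0 xA xB]] := card_lt_exists_orthogonal (f A JA) (f B JB) JAB.
have fE D (J : pred 'I_n) j : x *m f D J = 0 -> j \in J -> coordmx D x 0 j = 0.
  move=> /rowP xf jJ; have := xf (enum_rank_in jJ j).
  rewrite /coordmx !mxE; apply: etrans.
  by apply: eq_bigr => i _; rewrite !mxE enum_rankK_in.
have xa : rnorm (x *m A^t*) <= a * rnorm x.
  apply: rnorm_mul_le => // j; apply: contraR; rewrite -ltNge => aj.
  by apply/eqP; apply: fE xA _.
have xb : b * rnorm x <= rnorm (x *m B^t*).
  apply: rnorm_mul_ge => // j; apply: contraR; rewrite -ltNge => aj.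
  by apply/eqP; apply: fE xB _.
(* With |.| for [rnorm], b |x| <= |x B^*| <= c |x A^*| + e |x| <= (c a + e) |x|, and |x| > 0
   cancels. *)
rewrite -(ler_pM2r (_ : 0 < rnorm x)) ?rnorm_gt0//.
rewrite (le_trans xb)// (le_trans (h x))// mulrDl lerD2r -mulrA.
exact: ler_wpM2l.
Qed.

Lemma sv_le_opnorm B j : sv B j <= opnorm B.
Proof.
have n0 : (0 < n)%N by exact: leq_ltn_trans (ltn_ord j).
rewrite leNgt; apply/negP => h.
have := @count_gt_nth R (singular_values B) 0 (sorted_singular_values B).
by rewrite count_singular_values leqn0 => /eqP/card0_eq/(_ j); rewrite !inE h.
Qed.

Lemma rnorm_mul_opnorm B (x : 'rV_n) : rnorm (x *m B^t*) <= opnorm B * rnorm x.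
Proof.
apply: rnorm_mul_le => [|j _]; last exact: sv_le_opnorm.
(* For [n = 0] the list is empty and the norm is the default value 0. *)
rewrite /opnorm /singval /=; have [n0|n0] := posnP n.
  by rewrite nth_default// size_singular_values n0.
by apply: (@singular_values_ge0 B); rewrite mem_nth ?size_singular_values.
Qed.

Lemma weyl_singular_values A B k : (k < n)%N ->
  nth 0 (singular_values B) k <= nth 0 (singular_values A) k + opnorm (B - A).
Proof.
move=> kn; rewrite -[X in X + _]mul1r; apply: nth_singular_values_le => //.
  rewrite /opnorm /singval (@singular_values_ge0 (B - A))//.
  by rewrite mem_nth ?size_singular_values// (leq_ltn_trans _ kn).
move=> x; rewrite mul1r.
have -> : x *m B^t* = x *m A^t* + x *m (B - A)^t*.
  by rewrite -mulmxDr -map_mxD -linearD /= addrC subrK.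
by rewrite (le_trans (ler_rnormD _ _))// lerD2l rnorm_mul_opnorm.
Qed.

(** Opposite matrices have the same Gram matrix. *)
Lemma opnormC A B : opnorm (A - B) = opnorm (B - A).
Proof.
have E (D : 'M[R[i]]_n) : (- D)^t* *m - D = D^t* *m D.
  have -> : (- D)^t* = - D^t* by apply/matrixP => i j; rewrite !mxE rmorphN.
  by rewrite mulNmx mulmxN opprK.
by rewrite -opprB /opnorm /singval /singular_values E.
Qed.

Lemma nth_singular_valuesZ (a : R) B k : 0 <= a -> (k < n)%N ->
  nth 0 (singular_values (a%:C *: B)) k = a * nth 0 (singular_values B) k.
Proof.
have aux (c : R) (D : 'M[R[i]]_n) : 0 <= c -> (k < n)%N ->
    nth 0 (singular_values (c%:C *: D)) k <= c * nth 0 (singular_values D) k.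
  move=> c0 kn; rewrite -[X in _ <= X]addr0.
  apply: nth_singular_values_le => // x.
  rewrite mul0r addr0 linearZ map_mxZ /= -scalemxAr.
  rewrite conj_Creal ?ger0_real ?ler0c//.
  by rewrite rnormZ.
move=> a0 kn; apply/eqP; rewrite eq_le aux//=.
have [->|an0] := eqVneq a 0.
  rewrite mul0r (@singular_values_ge0 (0%:C *: B))//.
  by rewrite mem_nth ?size_singular_values.
have ap : 0 < a by rewrite lt0r an0.
(* The reverse inequality is the upper bound for the factor [a^-1] applied to the scaled matrix. *)
have := @aux a^-1 (a%:C *: B); rewrite scalerA -rmorphM mulVf//= scale1r.
move=> /(_ (ltW _) kn); rewrite invr_gt0 => /(_ ap).
by rewrite [X in _ <= X]mulrC ler_pdivlMr// mulrC.
Qed.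

End SingularValues.

(** * Characteristic polynomials and the sign of real roots *)

Lemma char_poly_conj (F : fieldType) n (P M : 'M[F]_n) : P \in unitmx ->
  char_poly (invmx P *m M *m P) = char_poly M.
Proof.
move=> Pu; rewrite /char_poly.
have -> : char_poly_mx (invmx P *m M *m P) =
    map_mx polyC (invmx P) *m char_poly_mx M *m map_mx polyC P.
  rewrite /char_poly_mx mulmxBr mulmxBl !map_mxM /=; congr (_ - _).
  by rewrite mul_mx_scalar -scalemxAl -map_mxM mulVmx// map_mx1 scalemx1.
rewrite !det_mulmx mulrAC -det_mulmx -map_mxM mulVmx// map_mx1 det1 mul1r.
by [].
Qed.

Section RootsNegative.
Variable F : numDomainType.

Lemma coef_prod_XsubC_gt0 (s : seq F) : all (fun u => u < 0) s ->
  forall k, (k <= size s)%N -> 0 < (\prod_(u <- s) ('X - u%:P))`_k.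
Proof.
move=> sneg k ks; set p := \prod_(u <- s) _.
(* Nonnegativity of all coefficients is carried along: at the top degree the recurrence p_(k-1) - u
   p_k involves a coefficient beyond the degree of [p]. *)
suff [_ ->] : 0 <= p`_k /\ ((k <= size s)%N -> 0 < p`_k) by [].
rewrite {}/p; elim: s k sneg {ks} => [k _|u s IH k /= /andP[u0 sneg]].
  by rewrite big_nil coef1; case: k => [|k]; rewrite ?ltr01 ?ler01 ?lexx.
rewrite big_cons; set p := \prod_(u <- s) _.
have -> : (('X - u%:P) * p)`_k = (if k == 0%N then 0 else p`_k.-1) + (- u) * p`_k.
  by rewrite mulrBl coefB coefXM coefCM mulNr.
have [pk0 pk] := IH k sneg; have [pk10 pk1] := IH k.-1 sneg.
have nu : 0 < - u by rewrite oppr_gt0.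
split; first by rewrite addr_ge0 ?mulr_ge0 ?(ltW nu)//; case: ifP.
case: (posnP k) => [k0|k0 ks].
  by move=> _; rewrite k0 add0r mulr_gt0// -k0 pk ?k0.
by rewrite ltr_pwDl ?mulr_ge0 ?(ltW nu)// pk1// -ltnS prednK.
Qed.

(** At a point [u >= 0] the value of [p] is at least its constant term, which is positive. *)
Lemma coef_gt0_root_lt0 (p : {poly F}) (u : F) : u \is Num.real ->
  (forall k, (k < size p)%N -> 0 < p`_k) -> p != 0 -> root p u -> u < 0.
Proof.
move=> ur pk p0 /rootP pu; case: (real_ltP ur (real0 F)) => // u0.
have : 0 < p.[u].
  rewrite horner_coef; have sp : (0 < size p)%N by rewrite size_poly_gt0.
  rewrite (bigD1 (Ordinal sp))//= expr0 mulr1 ltr_pwDl ?pk// sumr_ge0// => i _.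
  by rewrite mulr_ge0 ?exprn_ge0// ltW// pk.
by rewrite pu ltxx.
Qed.

End RootsNegative.

Section AffineGram.
Variables (R : realType) (n : nat).
Implicit Type B : 'M[R[i]]_n.

(** Its eigenvalues are a + c s^2 for the singular values s. Their negativity says that all s < t
    when (a, c) = (-t^2, 1), and that all s > t when (a, c) = (t^2, -1), for t >= 0. *)
Definition affine_gram (a c : R) B : 'M[R[i]]_n := a%:C%:M + c%:C *: gram B.

Lemma char_poly_affine_gram a c B :
  char_poly (affine_gram a c B) =
  \prod_(u <- [seq (a + c * sv B j ^+ 2)%:C | j : 'I_n]) ('X - u%:P).
Proof.
have Pu := spectral_unit (gram B).
pose D := a%:C%:M + c%:C *: diag_mx (spectral_diag (gram B)).
have -> : affine_gram a c B = invmx (gram_basis B) *m D *m gram_basis B.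
  rewrite /D mulmxDr mulmxDl mul_mx_scalar -scalemxAl mulVmx// scalemx1.
  rewrite -scalemxAr -scalemxAl /affine_gram; congr (_ + _ *: _).
  by rewrite [LHS]gram_spectral invmx_unitary ?spectral_unitarymx.
rewrite char_poly_conj// char_poly_trig.
  rewrite big_map big_enum; apply: eq_bigr => j _; rewrite !mxE eqxx !mulr1n.
  by rewrite -sv_sqr -rmorphM -rmorphD.
apply/is_trig_mxP => i j ij; rewrite !mxE -val_eqE (ltn_eqF ij) !mulr0n.
by rewrite mulr0 addr0.
Qed.

(** The left side speaks of eigenvalues listed in an unspecified order, whose measurability is
    unclear; the right side only of polynomial expressions in the entries and their conjugates. A
    characteristic polynomial has [n.+1] coefficients. *)
Lemma affine_gram_neg a c B :
  (forall j, a + c * sv B j ^+ 2 < 0) <->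
  (forall k, (k < n.+1)%N -> 0 < (char_poly (affine_gram a c B))`_k).
Proof.
split=> [h k kn|h j].
  rewrite char_poly_affine_gram; apply: coef_prod_XsubC_gt0.
    by apply/allP => u /mapP[j _ ->]; rewrite ltcE eqxx /= h.
  by rewrite size_map size_enum_ord.
rewrite -ltcR; apply: (@coef_gt0_root_lt0 _ (char_poly (affine_gram a c B))).
- by apply/complex_realP; exists (a + c * sv B j ^+ 2).
- by rewrite size_char_poly.
- by rewrite monic_neq0// char_poly_monic.
- rewrite char_poly_affine_gram root_prod_XsubC; apply/mapP.
  by exists j; rewrite ?mem_enum.
Qed.

End AffineGram.

(** * Measurability of determinants and of characteristic polynomials *)

Section RingClosedFunctions.
Variables (T : Type) (S : comNzRingType) (Q : (T -> S) -> Prop).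
Hypothesis Qcst : forall c, Q (fun=> c).
Hypothesis QD : forall f g, Q f -> Q g -> Q (fun w => f w + g w).
Hypothesis QM : forall f g, Q f -> Q g -> Q (fun w => f w * g w).

Lemma closed_sum (I : Type) (r : seq I) (f : I -> T -> S) :
  (forall i, Q (f i)) -> Q (fun w => \sum_(i <- r) f i w).
Proof.
move=> Qf; elim: r => [|i r IH]; first by under eq_fun do rewrite big_nil.
by under eq_fun do rewrite big_cons; exact: QD.
Qed.

Lemma closed_prod (I : Type) (r : seq I) (f : I -> T -> S) :
  (forall i, Q (f i)) -> Q (fun w => \prod_(i <- r) f i w).
Proof.
move=> Qf; elim: r => [|i r IH]; first by under eq_fun do rewrite big_nil.
by under eq_fun do rewrite big_cons; exact: QM.
Qed.

(** Leibniz expansion. The class [Q] stays abstract because it serves both complex-valued functions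
    and, for the characteristic polynomial, polynomial-valued ones. *)
Lemma closed_det n (M : T -> 'M[S]_n) :
  (forall i j, Q (fun w => M w i j)) -> Q (fun w => \det (M w)).
Proof.
move=> QMx; apply: closed_sum => s; apply: QM => //.
exact: closed_prod.
Qed.

End RingClosedFunctions.

Section MeasurableComplex.
Variables (R : realType) (d : measure_display) (T : measurableType d).
Implicit Types (f g : T -> R[i]) (p q : T -> {poly R[i]}).

Definition measurable_complex f :=
  measurable_fun setT (fun w => complex.Re (f w)) /\
  measurable_fun setT (fun w => complex.Im (f w)).

Lemma measurable_complex_cst (c : R[i]) : measurable_complex (fun=> c).
Proof. by split; exact: measurable_cst. Qed.

Lemma measurable_complexD f g : measurable_complex f -> measurable_complex g ->
  measurable_complex (fun w => f w + g w).
Proof.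
move=> [fr fi] [gr gi]; split.
  rewrite [X in measurable_fun _ X](_ : _ =
    (fun w => complex.Re (f w) + complex.Re (g w))); last first.
    by apply/funext => w; case: (f w) (g w) => [a b] [c e].
  exact: measurable_funD.
rewrite [X in measurable_fun _ X](_ : _ =
  (fun w => complex.Im (f w) + complex.Im (g w))); last first.
  by apply/funext => w; case: (f w) (g w) => [a b] [c e].
exact: measurable_funD.
Qed.

Lemma measurable_complexM f g : measurable_complex f -> measurable_complex g ->
  measurable_complex (fun w => f w * g w).
Proof.
move=> [fr fi] [gr gi]; split.
  rewrite [X in measurable_fun _ X](_ : _ = (fun w =>
    complex.Re (f w) * complex.Re (g w) - complex.Im (f w) * complex.Im (g w))).
    by apply: measurable_funB; exact: measurable_funM.
  by apply/funext => w; case: (f w) (g w) => [a b] [c e].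
rewrite [X in measurable_fun _ X](_ : _ = (fun w =>
  complex.Re (f w) * complex.Im (g w) + complex.Im (f w) * complex.Re (g w))).
  by apply: measurable_funD; exact: measurable_funM.
by apply/funext => w; case: (f w) (g w) => [a b] [c e].
Qed.

Lemma measurable_complex_conj f : measurable_complex f ->
  measurable_complex (fun w => Num.conj (f w)).
Proof.
move=> [fr fi]; split.
  rewrite [X in measurable_fun _ X](_ : _ = (fun w => complex.Re (f w)))//.
  by apply/funext => w; case: (f w) => [a b].
rewrite [X in measurable_fun _ X](_ : _ = (fun w => - complex.Im (f w))).
  exact: measurable_funN.
by apply/funext => w; case: (f w) => [a b].
Qed.

Lemma measurable_complex_sqr_normc f : measurable_complex f ->
  measurable_fun setT (fun w => Normc.normc (f w) ^+ 2).
Proof.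
move=> [fr fi]; rewrite [X in measurable_fun _ X](_ : _ = (fun w =>
  complex.Re (f w) ^+ 2 + complex.Im (f w) ^+ 2)).
  by apply: measurable_funD; exact: measurable_funX.
apply/funext => w; case: (f w) => [a b] /=.
by rewrite sqr_sqrtr// addr_ge0 ?sqr_ge0.
Qed.

(** In the order on complex numbers, [0 < z] means that z has zero imaginary part and positive real
    part. *)
Lemma measurable_complex_gt0 f : measurable_complex f ->
  measurable [set w | 0 < f w].
Proof.
move=> [fr fi]; rewrite [X in measurable X](_ : _ =
    (fun w => complex.Im (f w)) @^-1` [set 0] `&`
    (fun w => complex.Re (f w)) @^-1` `]0, +oo[).
  apply: measurableI; rewrite -[X in measurable X]setTI.
    by apply: fi => //; exact: measurable_set1.
  by apply: fr => //; exact: measurable_itv.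
apply/seteqP; split => w /=; rewrite ltcE in_itv /= andbT.
  by move=> /andP[/eqP -> ->].
by move=> [-> ->]; rewrite eqxx.
Qed.

Definition measurable_poly p := forall k, measurable_complex (fun w => (p w)`_k).

Lemma measurable_poly_cst (c : {poly R[i]}) : measurable_poly (fun=> c).
Proof. by move=> k; exact: measurable_complex_cst. Qed.

Lemma measurable_polyD p q : measurable_poly p -> measurable_poly q ->
  measurable_poly (fun w => p w + q w).
Proof.
by move=> mp mq k; under eq_fun do rewrite coefD; exact: measurable_complexD.
Qed.

Lemma measurable_polyM p q : measurable_poly p -> measurable_poly q ->
  measurable_poly (fun w => p w * q w).
Proof.
move=> mp mq k; under eq_fun do rewrite coefM.
apply: closed_sum => [c|f g|i]; first exact: measurable_complex_cst.
  exact: measurable_complexD.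
exact: measurable_complexM.
Qed.

Lemma measurable_polyC f : measurable_complex f ->
  measurable_poly (fun w => (f w)%:P).
Proof.
move=> mf k; under eq_fun do rewrite coefC.
by case: (k == 0%N) => //; exact: measurable_complex_cst.
Qed.

Section RandomMatrix.
Variables (n : nat) (B : T -> 'M[R[i]]_n).
Hypothesis mB : random_matrix B.

Let mBij i j : measurable_complex (fun w => B w i j). Proof. exact: mB. Qed.

Lemma measurable_det : measurable_complex (fun w => \det (B w)).
Proof.
by apply: closed_det; [exact: measurable_complex_cst|
  exact: measurable_complexD|exact: measurable_complexM|].
Qed.

Lemma random_matrix_gram : random_matrix (fun w => gram (B w)).
Proof.
move=> i j; rewrite -/(measurable_complex _); under eq_fun do rewrite mxE.
apply: closed_sum => [c|f g|k]; first exact: measurable_complex_cst.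
  exact: measurable_complexD.
apply: measurable_complexM => //; under eq_fun do rewrite !mxE.
exact: measurable_complex_conj.
Qed.

Lemma random_matrix_affine a c : random_matrix (fun w => a + c *: B w).
Proof.
move=> i j; rewrite -/(measurable_complex _); under eq_fun do rewrite !mxE.
apply: measurable_complexD; first exact: measurable_complex_cst.
apply: measurable_complexM => //; exact: measurable_complex_cst.
Qed.

Lemma measurable_char_poly : measurable_poly (fun w => char_poly (B w)).
Proof.
apply: closed_det; [exact: measurable_poly_cst|exact: measurable_polyD|
  exact: measurable_polyM|move=> i j].
under eq_fun do rewrite !mxE -polyCN.
apply: measurable_polyD; first exact: measurable_poly_cst.
apply: measurable_polyC; rewrite (_ : (fun _ => _) = fun w => -1 * B w i j).
  by apply: measurable_complexM => //; exact: measurable_complex_cst.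
by apply/funext => w; rewrite mulN1r.
Qed.

End RandomMatrix.

Lemma measurable_affine_gram_neg n (B : T -> 'M[R[i]]_n) a c :
  random_matrix B ->
  measurable [set w | forall j, a + c * sv (B w) j ^+ 2 < 0].
Proof.
move=> mB; rewrite [X in measurable X](_ : _ =
    \bigcap_(k in `I_n.+1) [set w | 0 < (char_poly (affine_gram a c (B w)))`_k]).
  apply: fin_bigcap_measurable => // k _; apply: measurable_complex_gt0.
  apply: measurable_char_poly; apply: random_matrix_affine.
  exact: random_matrix_gram.
by apply/seteqP; split => w /= /affine_gram_neg.
Qed.

End MeasurableComplex.

(** * Extreme singular values: measurability and Markov's inequality *)

Section ExtremeSingularValues.
Variables (R : realType) (n : nat).
Implicit Types B : 'M[R[i]]_n.

Lemma nth_singular_values_sv B k : (k < n)%N ->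
  exists j, nth 0 (singular_values B) k = sv B j.
Proof.
move=> kn.
have : nth 0 (singular_values B) k \in singular_values B.
  by rewrite mem_nth ?size_singular_values.
by rewrite (perm_mem (perm_singular_values B)) => /mapP[j _ ->]; exists j.
Qed.

Lemma nth_singular_values_ge0 B k : 0 <= nth 0 (singular_values B) k.
Proof.
have [kn|nk] := ltnP k n; last by rewrite nth_default ?size_singular_values.
by have [j ->] := nth_singular_values_sv B kn; exact: sv_ge0.
Qed.

Lemma opnorm_lt B (t : R) : (0 < n)%N ->
  opnorm B < t <-> (forall j, sv B j < t).
Proof.
move=> n0; split=> [h j|h]; first exact: le_lt_trans (sv_le_opnorm B j) h.
by rewrite /opnorm /singval; have [j ->] := nth_singular_values_sv B n0.
Qed.

Lemma singval_min_le_sv B j : singval B n <= sv B j.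
Proof.
have n0 : (0 < n)%N by exact: leq_ltn_trans (ltn_ord j).
have n1 : (n.-1 < n)%N by rewrite ltn_predL.
rewrite leNgt; apply/negP => h; have := count_lt_nth (sorted_singular_values B).
(* At the last index [n.-1] the count of smaller entries is below n - (n - 1) = 1, hence zero. *)
rewrite size_singular_values => /(_ _ n1); rewrite -subn1 subKn// ltnS.
rewrite (count_singular_values B (fun x => x < _)) leqn0.
by move=> /eqP/card0_eq/(_ j); rewrite !inE subn1 h.
Qed.

Lemma singval_min_gt B (t : R) : (0 < n)%N ->
  t < singval B n <-> (forall j, t < sv B j).
Proof.
move=> n0; split=> [h j|h]; first exact: lt_le_trans h (singval_min_le_sv B j).
have n1 : (n.-1 < n)%N by rewrite ltn_predL.
by rewrite /singval; have [j ->] := nth_singular_values_sv B n1.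
Qed.

End ExtremeSingularValues.

Section MeasurableSingularValues.
Variables (R : realType) (d : measure_display) (T : measurableType d).
Variables (n : nat) (B : T -> 'M[R[i]]_n).
Hypothesis n0 : (0 < n)%N.
Hypothesis mB : random_matrix B.

Lemma measurable_opnorm : measurable_fun setT (fun w => opnorm (B w)).
Proof.
(* The rays below [t] generate the Borel sets. For [t <= 0] the preimage is empty; otherwise s < t
   is equivalent to s^2 < t^2. *)
move=> mT; apply: (measurability _ (RGenInftyO.measurableE R)) => //.
move=> _ [_ [t ->] <-]; rewrite setTI.
have [t0|t0] := ltP 0 t; last first.
  rewrite [X in measurable X](_ : _ = set0)//; apply/seteqP; split => // w /=.
  by rewrite in_itv /= ltNge (le_trans t0)// nth_singular_values_ge0.
rewrite [X in measurable X](_ : _ =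
    [set w | forall j, - t ^+ 2 + 1 * sv (B w) j ^+ 2 < 0]).
  exact: measurable_affine_gram_neg.
have E w j : (- t ^+ 2 + 1 * sv (B w) j ^+ 2 < 0) = (sv (B w) j < t).
  by rewrite mul1r addrC subr_lt0 ltr_pXn2r// nnegrE ?sv_ge0// ltW.
apply/seteqP; split => w /=; rewrite in_itv /= => h.
  by move=> j; rewrite E; have /opnorm_lt-> := h.
by apply/opnorm_lt => // j; rewrite -E.
Qed.

Lemma measurable_singval_min (t : R) : 0 <= t ->
  measurable [set w | singval (B w) n <= t].
Proof.
move=> t0; rewrite [X in measurable X](_ : _ =
    ~` [set w | forall j, t ^+ 2 + (-1) * sv (B w) j ^+ 2 < 0]).
  exact/measurableC/measurable_affine_gram_neg.
have E w j : (t ^+ 2 + (-1) * sv (B w) j ^+ 2 < 0) = (t < sv (B w) j).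
  by rewrite mulN1r subr_lt0 ltr_pXn2r// nnegrE sv_ge0.
apply/seteqP; split => w /=.
  rewrite leNgt => /negP h h'; apply: h.
  by apply/singval_min_gt => // j; rewrite -E.
move=> h; rewrite leNgt; apply/negP => /singval_min_gt h'; apply: h => j.
by rewrite E h'.
Qed.

Lemma markov_opnorm (P : probability T R) (m tau : R) : 0 < m -> 0 < tau ->
  ('E_P[fun w => opnorm (B w)] <= m%:E)%E ->
  (P [set w | (tau * m <= opnorm (B w))%R] <= (tau^-1)%:E)%E.
Proof.
move=> m0 tau0 Em; have tm : 0 < tau * m by rewrite mulr_gt0.
(* Markov's inequality at the threshold [tau * m]; as [m] bounds the expectation, the quotient is
   [tau^-1]. *)
have := @le_integral_comp_abse _ _ _ P _ measurableT
  (fun w => (opnorm (B w))%:E) (tau * m) id (@measurable_id _ _ _) _ _ _ tm.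
rewrite setTI => /(_ (fun r r0 => r0) (fun x y _ _ h => h)).
have op0 w : `|(opnorm (B w))%:E|%E = (opnorm (B w))%:E.
  by rewrite gee0_abs// lee_fin nth_singular_values_ge0.
under eq_set do rewrite op0 lee_fin.
under eq_integral do rewrite op0.
have mop : measurable_fun setT (fun w => (opnorm (B w))%:E).
  exact/measurable_EFinP/measurable_opnorm.
move=> /(_ mop).
rewrite -[X in (_ <= X)%E -> _](_ : 'E_P[fun w => opnorm (B w)]%E = _); last first.
  by rewrite unlock.
move=> /le_trans /(_ Em); rewrite -lee_pdivlMl// => /le_trans; apply.
by rewrite -EFinM lee_fin invfM mulrAC -mulrA divff ?mulr1 ?gt_eqF.
Qed.

End MeasurableSingularValues.

(** * Deterministic estimate of the log-determinant, and its event *)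

Section LogDeterminant.
Variable R : realType.

Lemma lnB_le (x y : R) : 0 < x -> 0 < y -> ln x - ln y <= (x - y) / y.
Proof.
move=> x0 y0; rewrite -ln_div ?posrE//.
have -> : x / y = 1 + (x - y) / y.
  by rewrite mulrBl divff ?gt_eqF// addrCA subrr addr0.
by rewrite le_ln1Dx// mulrBl divff ?gt_eqF// ltrBDl addrN divr_gt0.
Qed.

(** Both [a] and [b] are at least alpha / 2, so the two one-sided bounds from [lnB_le] are at most
    eta / (alpha / 2). *)
Lemma ln_perturb (a b alpha eta : R) : 0 < alpha -> eta <= alpha / 2 ->
  alpha < a -> `|b - a| <= eta -> `|ln b - ln a| <= 2 * (eta / alpha).
Proof.
move=> alpha0 ea aa; rewrite ler_distl => /andP[ab ba].
have a0 : 0 < a by rewrite (lt_trans alpha0).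
have b2 : alpha / 2 <= b by lra.
have b0 : 0 < b by lra.
have eta0 : 0 <= eta by lra.
have i0 : 0 < alpha^-1 by rewrite invr_gt0.
rewrite ler_norml -lerNl opprB; apply/andP; split.
  apply: le_trans (lnB_le a0 b0) _.
  rewrite ler_pdivrMr// mulrA mulrAC ler_pdivlMr//; nra.
apply: le_trans (lnB_le b0 a0) _.
rewrite ler_pdivrMr// mulrA mulrAC ler_pdivlMr//; nra.
Qed.

(** From N^(-q) <= b <= 2 <= N, ln b lies between - q ln N and ln N; the factor [q + 1] covers both
    signs. *)
Lemma ln_small (N : nat) (b q : R) : (2 <= N)%N -> 0 <= q ->
  N%:R `^ (- q) <= b -> b <= 2 -> `|ln b| <= (q + 1) * ln N%:R.
Proof.
move=> N2 q0 qb b2; have N0 : 0 < (N%:R : R) by rewrite ltr0n (leq_trans _ N2).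
have p0 : 0 < (N%:R : R) `^ (- q) by rewrite powR_gt0.
have b0 : 0 < b by rewrite (lt_le_trans p0).
have l0 : 0 <= ln (N%:R : R) by rewrite ln_ge0// ler1n (leq_trans _ N2).
have lN : ln b <= ln (N%:R : R).
  by rewrite ler_ln ?posrE// (le_trans b2)// (ler_nat _ 2 N).
have lb : - q * ln (N%:R : R) <= ln b by rewrite -ln_powR ler_ln ?posrE.
by rewrite ler_norml; apply/andP; split; nra.
Qed.

Lemma normc_det n (B : 'M[R[i]]_n) :
  Normc.normc (\det B) = \prod_(i < n) nth 0 (singular_values B) i.
Proof.
transitivity (\prod_(s <- singular_values B) s).
  by rewrite det_sv (perm_big _ (perm_singular_values B)) big_map big_enum.
by rewrite (big_nth 0) size_singular_values big_mkord.
Qed.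

Lemma ln_prod_ord n (f : 'I_n -> R) : (forall i, 0 < f i) ->
  ln (\prod_(i < n) f i) = \sum_(i < n) ln (f i).
Proof.
move=> f0; suff [] : 0 < \prod_(i < n) f i /\
  ln (\prod_(i < n) f i) = \sum_(i < n) ln (f i) by [].
elim/big_ind2: _ => [|x1 x2 y1 y2 [x10 <-] [y10 <-]|i _] //.
  by rewrite ltr01 ln1.
by rewrite mulr_gt0// lnM// posrE.
Qed.

Lemma log_det_bound (N : nat) (A B : 'M[R[i]]_N) (alpha eta q nu : R) :
  (2 <= N)%N -> 0 < alpha -> alpha <= 1 -> eta <= alpha / 2 -> 0 <= q ->
  opnorm (B - A) <= eta -> N%:R `^ (- q) <= singval B N ->
  (count (fun s : R => 0 <= s <= alpha) (singular_values A))%:R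
    <= nu * (N%:R / ln N%:R) ->
  0 < Normc.normc (\det B) /\
  `| N%:R^-1 * ln (Normc.normc (\det B))
     - N%:R^-1 * \sum_(s <- singular_values A | alpha < s) ln s |
  <= (q + 1) * nu + 2 * (eta / alpha).
Proof.
move=> N2 alpha0 alpha1 ea q0 BA Bq cA.
have N0 : (0 < N)%N by rewrite (leq_trans _ N2).
have NR0 : 0 < (N%:R : R) by rewrite ltr0n.
pose a (i : 'I_N) := nth 0 (singular_values A) i.
pose b (i : 'I_N) := nth 0 (singular_values B) i.
have eta0 : 0 <= eta by exact: le_trans (nth_singular_values_ge0 _ _) BA.
have bq i : N%:R `^ (- q) <= b i.
  apply: le_trans Bq _; rewrite /b.
  by have [j ->] := nth_singular_values_sv B (ltn_ord i); exact: singval_min_le_sv.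
have b0 i : 0 < b i by rewrite (lt_le_trans _ (bq i))// powR_gt0.
have ab i : `|b i - a i| <= eta.
  rewrite ler_distl; apply/andP; split.
    rewrite lerBlDr; apply: le_trans (weyl_singular_values B A (ltn_ord i)) _.
    by rewrite opnormC lerD2l.
  by apply: le_trans (weyl_singular_values A B (ltn_ord i)) _; rewrite lerD2l.
have detE : Normc.normc (\det B) = \prod_(i < N) b i by exact: normc_det.
split; first by rewrite detE prodr_gt0.
rewrite detE ln_prod_ord// (big_nth 0) size_singular_values big_mkord.
rewrite -mulrBr normrM gtr0_norm ?invr_gt0// ler_pdivrMl//.
(* Split the determinant sum at [alpha]: the large indices pair with the truncated sum, the small
   ones remain. *)
rewrite (bigID (fun i => alpha < a i)) /= addrAC -sumrB.
apply: le_trans (ler_normD _ _) _.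
have -> : N%:R * ((q + 1) * nu + 2 * (eta / alpha)) =
  \sum_(i < N) (2 * (eta / alpha)) + (q + 1) * (nu * N%:R).
  by rewrite sumr_const card_ord -[X in _ = X + _]mulr_natl; ring.
apply: lerD.
  apply: le_trans (ler_norm_sum _ _ _) _; rewrite big_mkcond.
  apply: ler_sum => i _; case: ifP => [ai|_]; first exact: ln_perturb (ab i).
  by rewrite mulr_ge0// divr_ge0// ltW.
have lN : 0 < ln (N%:R : R) by rewrite ln_gt0// ltr1n.
apply: le_trans (_ : \sum_(i < N | ~~ (alpha < a i)) (q + 1) * ln N%:R <= _).
  apply: le_trans (ler_norm_sum _ _ _) _; apply: ler_sum => i.
  rewrite -leNgt => ai; apply: ln_small => //.
  (* Here b_i <= alpha + eta <= 3/2, below the bound 2 required by [ln_small]. *)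
  by have := ab i; rewrite ler_distl => /andP[_]; lra.
have -> : \sum_(i < N | ~~ (alpha < a i)) (q + 1) * ln N%:R =
  (q + 1) * ln N%:R *
  (count (fun s : R => 0 <= s <= alpha) (singular_values A))%:R.
  rewrite sumr_const -[LHS]mulr_natr; congr (_ * _%:R).
  rewrite -sum1_count (big_nth 0) size_singular_values big_mkord sum1_card.
  by apply: eq_card => i; rewrite /in_mem /= -leNgt nth_singular_values_ge0.
(* The factor ln N of each small term cancels the one in the bound on their number. *)
apply: le_trans (ler_wpM2l _ cA) _; first by rewrite mulr_ge0// ?addr_ge0// ltW.
rewrite le_eqVlt; apply/orP; left; apply/eqP; field.
by rewrite gt_eqF.
Qed.

End LogDeterminant.

(** Since [lne 0] is -oo, a finite distance forces [x] to be positive: the event of the theorem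
    includes that the determinant does not vanish. *)
Lemma lne_dist_le (R : realType) (k c r x : R) : 0 < k -> 0 <= x ->
  (`|k%:E * lne x%:E - c%:E| <= r%:E)%E = (0 < x) && (`|k * ln x - c| <= r).
Proof.
move=> k0; rewrite le_eqVlt => /orP[/eqP <-|x0]; last by rewrite lne_EFin// x0.
rewrite ltxx le0_lneNy// gt0_muleNy ?lte_fin//.
Qed.

Lemma measurable_lne_normc_dist (R : realType) d (T : measurableType d)
    (f : T -> R[i]) (k c r : R) : measurable_complex f -> 0 < k ->
  measurable [set w | (`|k%:E * lne (Normc.normc (f w))%:E - c%:E| <= r%:E)%E].
Proof.
move=> mf k0; have n0 w : 0 <= Normc.normc (f w).
  by rewrite -ler0c; exact: (normr_ge0 (f w)).
have mnormc : measurable_fun setT (fun w => Normc.normc (f w)).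
  (* The squared modulus is polynomial in the real and imaginary parts; the modulus is its power
     1/2. *)
  rewrite [X in measurable_fun _ X](_ : _ =
      (fun w => (Normc.normc (f w) ^+ 2) `^ 2^-1)).
    apply: (measurableT_comp (@measurable_powR R 2^-1)).
    exact: measurable_complex_sqr_normc.
  by apply/funext => w; rewrite powR12_sqrt ?sqr_ge0// sqrtr_sqr ger0_norm.
rewrite [X in measurable X](_ : _ =
    (fun w => Normc.normc (f w)) @^-1` `]0, +oo[ `&`
    (fun w => `|k * ln (Normc.normc (f w)) - c|) @^-1` `]-oo, r]).
  apply: measurableI; rewrite -[X in measurable X]setTI.
    by apply: mnormc => //; exact: measurable_itv.
  suff ml : measurable_fun setT (fun w => `|k * ln (Normc.normc (f w)) - c|).
    by apply: ml => //; exact: measurable_itv.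
  apply: measurableT_comp; first exact: normr_measurable.
  apply: measurable_funB; last exact: measurable_cst.
  apply: measurable_funM; first exact: measurable_cst.
  exact: measurableT_comp (@measurable_ln R) mnormc.
apply/seteqP; split => w /=; rewrite lne_dist_le// !in_itv /= andbT.
  by move=> /andP[].
by move=> [-> ->].
Qed.

(** * The probabilistic estimate *)

Theorem theorem3 (R : realType) (kappa1 kappa2 L : R)
    (kappa1_gt0 : 0 < kappa1) (kappa2_ge0 : 0 <= kappa2) (L_gt0 : 0 < L) :
  exists gamma0 : R, 1 <= gamma0 /\
  forall gamma : R, gamma0 <= gamma ->
  forall C K C1 b : R, 0 < C -> 0 < K -> 0 < C1 -> 0 < b ->
  exists c0 C0 : R, [/\ 0 < c0, 0 < C0 &
  forall (d : nat -> measure_display) (T : forall N, measurableType (d N))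
    (P : forall N, probability (T N) R) (G : forall N, T N -> 'M[R[i]]_N)
    (beta : R -> R) (eps : R -> R -> nat -> R),
  noise_assumption P G kappa1 C1 beta eps ->
  beta (kappa2 + gamma) = b ->
  forall nu : nat -> R, (forall N, 0 <= nu N) -> nu @ \oo --> (0 : R) ->
  forall (N : nat) (A : 'M[R[i]]_N) (alpha tau delta : R),
  (2 <= N)%N ->
  opnorm A <= K * N%:R `^ kappa2 ->
  C * N%:R `^ (- L) <= alpha -> alpha <= 1 ->
  (count (fun s : R => 0 <= s <= alpha) (singular_values A))%:R
    <= nu N * (N%:R / ln N%:R) ->
  0 < tau ->
  N%:R `^ (- gamma) <= delta ->
  delta <= c0 * N%:R `^ (- kappa1) * alpha * tau^-1 ->
  ((1 - eps (kappa2 + gamma)%R K N - tau^-1)%:E <=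
   P N [set w |
     `| (N%:R^-1)%:E * lne (Normc.normc (\det (A + delta%:C *: G N w)))%:E
        - (N%:R^-1 * \sum_(s <- singular_values A | (alpha < s)%R) ln s)%:E |
     <= (C0 * (nu N + alpha^-1 * N%:R `^ kappa1 * delta * tau))%:E])%E].
Proof.
exists 1; split=> // gamma gamma1 C K C1 b C0 K0 C10 b0.
have gamma0 : 0 < gamma by rewrite (lt_le_trans ltr01).
(* [c0] is chosen to give eta <= alpha / 2. [C0] adds the constant 2 C1 of the term 2 eta / alpha to
   the constant q + 1 = gamma + b + 1 of the small singular values. *)
exists (2 * C1)^-1, (2 * C1 + (gamma + b + 1)); split.
- by rewrite invr_gt0 mulr_gt0.
- by rewrite !addr_gt0// mulr_gt0.
move=> d T P G beta eps noise betab nu nu0 _ N A alpha tau delta N2 opA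
  alphaL alpha1 cA tau0 deltal deltau.
have N0 : (0 < N)%N by rewrite (leq_trans _ N2).
have NR0 : 0 < (N%:R : R) by rewrite ltr0n.
have pN x : 0 < (N%:R : R) `^ x by rewrite powR_gt0.
have alpha0 : 0 < alpha by rewrite (lt_le_trans _ alphaL)// mulr_gt0.
have delta0 : 0 < delta by rewrite (lt_le_trans _ deltal).
have theta0 : 0 < kappa2 + gamma by rewrite ltr_wpDl.
have mG : random_matrix (G N) by exact: (noise_random noise).
set q := gamma + b; have q0 : 0 <= q by rewrite addr_ge0// ltW.
pose m := C1 * N%:R `^ kappa1; have m0 : 0 < m by rewrite mulr_gt0.
pose D := (delta^-1)%:C *: A.
(* As 1 / delta <= N^gamma, dividing by delta raises the norm exponent from kappa2 to kappa2 +
   gamma. *)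
have opD : opnorm D <= K * N%:R `^ (kappa2 + gamma).
  rewrite /D /opnorm /singval nth_singular_valuesZ ?invr_ge0 ?(ltW delta0)//.
  rewrite powRD ?(gt_eqF NR0) ?implybT// mulrA mulrC.
  apply: ler_pM; rewrite ?invr_ge0 ?(ltW delta0) ?nth_singular_values_ge0//.
  by rewrite -(invrK (N%:R `^ gamma)) -powRN lef_pV2 ?posrE.
have Pmin := noise_anticoncentration noise theta0 K0 N0 opD.
rewrite betab in Pmin.
have Pop := markov_opnorm N0 mG m0 tau0 (noise_norm noise N0).
set S := [set w | _] in Pmin; set M := [set w | _] in Pop.
have mDG : random_matrix (fun w => D + G N w).
  by have := random_matrix_affine mG D 1; under eq_fun do rewrite scale1r.
have mS : measurable S.
  exact: (measurable_singval_min N0 mDG (ltW (pN _))).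
have mM : measurable M.
  rewrite -[X in measurable X]setTI (_ : M =
      (fun w => opnorm (G N w)) @^-1` `[tau * m, +oo[).
    by apply: (measurable_opnorm N0 mG) => //; exact: measurable_itv.
  by apply/seteqP; split => w /=; rewrite in_itv /= andbT.
set E := [set w | _].
have mE : measurable E.
  apply: measurable_lne_normc_dist; last by rewrite invr_gt0.
  apply: measurable_det; exact: random_matrix_affine.
(* Outside the bad events [S] (small least singular value) and [M] (large noise), the deterministic
   estimate applies. *)
have sub : ~` (S `|` M) `<=` E.
  move=> w /not_orP[/= /negP]; rewrite -ltNge => hS /negP; rewrite -ltNge => hM.
  pose B := A + delta%:C *: G N w.
  pose eta := delta * (tau * m).
  have BE : B = delta%:C *: (D + G N w).
    rewrite scalerDr /D scalerA -rmorphM divff ?gt_eqF//.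
    by rewrite rmorph1 scale1r.
  have BA : opnorm (B - A) <= eta.
    rewrite /B addrAC subrr add0r /opnorm /singval.
    by rewrite nth_singular_valuesZ ?(ltW delta0)// ler_pM2l// ltW.
  have Bq : N%:R `^ (- q) <= singval B N.
    rewrite BE /singval nth_singular_valuesZ ?(ltW delta0) ?ltn_predL//.
    (* N^(-q) = N^(-gamma) N^(-b), with delta >= N^(-gamma) and the least singular value of D + G
       above N^(-b). *)
    rewrite /q opprD powRD ?(gt_eqF NR0) ?implybT//.
    by apply: ler_pM; rewrite ?powR_ge0// ltW.
  have ea : eta <= alpha / 2.
    move: deltau; rewrite ler_pdivlMr// powRN invfM.
    rewrite [X in _ <= X](_ : _ = alpha / (2 * m)); last first.
      by rewrite /m !invfM; ring.
    rewrite ler_pdivlMr ?mulr_gt0// /eta => h.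
    rewrite ler_pdivlMr//; apply: le_trans h.
    by rewrite le_eqVlt; apply/orP; left; apply/eqP; ring.
  have [det0 detb] := log_det_bound N2 alpha0 alpha1 ea q0 BA Bq cA.
  rewrite /E /= lne_dist_le ?invr_gt0 ?(ltW det0)//; apply/andP; split=> //.
  apply: le_trans detb _.
  have t0 : 0 <= alpha^-1 * N%:R `^ kappa1 * delta * tau.
    by rewrite !mulr_ge0 ?invr_ge0// ltW.
  have -> : 2 * (eta / alpha) = 2 * C1 * (alpha^-1 * N%:R `^ kappa1 * delta * tau).
    by rewrite /eta /m; ring.
  have := nu0 N.
  move: (alpha^-1 * _ * _ * _) t0 => t t0 nuN0; rewrite /q; nra.
(* Union bound; passing to the complement gives the claimed probability. *)
have PE : (P N (S `|` M) <= (eps (kappa2 + gamma)%R K N + tau^-1)%:E)%E.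
  by rewrite EFinD (le_trans (measureU2 _ mS mM))// leeD.
have mSM : measurable (S `|` M) by exact: measurableU.
have : (P N (~` (S `|` M)) <= P N E)%E.
  by apply: le_measure; rewrite ?inE//; exact: measurableC.
rewrite probability_setC//; apply: le_trans.
by rewrite -addrA -opprD EFinB leeB.
Qed.
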